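(* Let $P=\{x\in\mathbb{R}^n : H^Tx\le \mathbb{1}\}$ be a full-dimensional polytope with the origin in its interior and $f$ facets, and let $K\subset\mathbb{R}^m$ be a closed convex cone. If $K^*$ is a nice cone and $A$ is a nonnegative $K^*$-map from $\mathbb{R}^f$ to $\mathbb{R}^m$, then both $A^*(K)$ and $\mathrm{Inn}_P(A)$ are closed.
   Context: Dual spaces are identified with the spaces themselves via the standard inner product; $\|\cdot\|$ is the Euclidean norm and $\mathbb{1}$ is the all-ones vector. $H=[h_1\ \cdots\ h_f]$ is an $n\times f$ matrix such that each inequality $\langle h_i,x\rangle\le 1$ defines a facet of $P$ (one for each facet). $C^*=\{y : \langle y,x\rangle\ge 0\ \forall x\in C\}$ denotes the dual cone of a cone $C$. A closed convex cone $C$ is nice if $C^*+F^\perp$ is closed for every face $F$ of $C$. A nonnegative $K^*$-map $A:\mathbb{R}^f\to\mathbb{R}^m$ is a linear map with $A(\mathbb{R}^f_+)\subseteq K^*$; $A^*$ is its adjoint (transpose), and $H^*(x)=H^Tx$. $\mathcal{O}_{in}^f=\{x\in\mathbb{R}^f : \sqrt{f-1}\,\|x\|\le \mathbb{1}^Tx\}$, and $\mathrm{Inn}_P(A)=\{x\in\mathbb{R}^n : \exists y\in K,\ \mathbb{1}-H^*(x)-A^*(y)\in\mathcal{O}_{in}^f\}$. *)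

(* Defs.v *)
From mathcomp Require Import all_boot all_order all_algebra.
From mathcomp Require Import all_classical all_reals all_analysis.

Set Implicit Arguments.
Unset Strict Implicit.
Unset Printing Implicit Defensive.

Import Order.TTheory GRing.Theory Num.Theory.
Import numFieldNormedType.Exports.

Local Open Scope classical_set_scope.
Local Open Scope ring_scope.

(* Topological notions ([closed], [interior]) on ['cV[R]_n] refer to the library's
   entrywise topology, which is the Euclidean topology of R^n.  The norm of the
   library on ['cV[R]_n] is however the sup norm, hence [enorm] below. *)

Definition dot (R : realType) (n : nat) (x y : 'cV[R]_n) : R :=
  \sum_(i < n) x i 0 * y i 0.

Definition enorm (R : realType) (n : nat) (x : 'cV[R]_n) : R :=
  Num.sqrt (dot x x).

Definition ones (R : realType) (f : nat) : 'cV[R]_f := const_mx 1.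

Definition orthant (R : realType) (f : nat) : set 'cV[R]_f :=
  [set x | forall i, 0 <= x i 0].

Definition minkowski_sum (R : realType) (n : nat) (S T : set 'cV[R]_n) :
  set 'cV[R]_n := [set x + y | x in S & y in T].

Definition closed_convex_cone (R : realType) (n : nat) (C : set 'cV[R]_n) : Prop :=
  [/\ C !=set0,
      forall (t : R) x, 0 <= t -> C x -> C (t *: x),
      convex_set C
    & closed C].

Definition dual_cone (R : realType) (n : nat) (C : set 'cV[R]_n) : set 'cV[R]_n :=
  [set y | forall x, C x -> 0 <= dot y x].

Definition orth_compl (R : realType) (n : nat) (F : set 'cV[R]_n) : set 'cV[R]_n :=
  [set y | forall x, F x -> dot y x = 0].

(* The empty set and [C] itself count as faces of [C]. *)
Definition is_face (R : realType) (n : nat) (C F : set 'cV[R]_n) : Prop :=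
  [/\ F `<=` C,
      convex_set F
    & forall x y (t : R), C x -> C y -> 0 < t < 1 ->
        F (t *: x + (1 - t) *: y) -> F x /\ F y].

Definition nice_cone (R : realType) (n : nat) (C : set 'cV[R]_n) : Prop :=
  closed_convex_cone C /\
  forall F, is_face C F -> closed (minkowski_sum (dual_cone C) (orth_compl F)).

Definition affinely_independent (R : realType) (n k : nat)
    (p : 'I_k -> 'cV[R]_n) : Prop :=
  forall c : 'I_k -> R,
    \sum_(i < k) c i *: p i = 0 -> \sum_(i < k) c i = 0 -> forall i, c i = 0.

(* Affine dimension [d]: [S] contains [d + 1] affinely independent points, but
   not [d + 2].  The empty set has no dimension in this sense. *)
Definition has_dim (R : realType) (n : nat) (S : set 'cV[R]_n) (d : nat) : Prop :=
  (exists2 p : 'I_d.+1 -> 'cV[R]_n,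
     forall i, S (p i) & affinely_independent p) /\
  (forall p : 'I_d.+2 -> 'cV[R]_n,
     (forall i, S (p i)) -> ~ affinely_independent p).

Definition is_polytope (R : realType) (n : nat) (P : set 'cV[R]_n) : Prop :=
  exists (k : nat) (v : 'I_k -> 'cV[R]_n),
    P = [set x | exists c : 'I_k -> R,
           [/\ forall i, 0 <= c i,
               \sum_(i < k) c i = 1
             & x = \sum_(i < k) c i *: v i]].

Definition is_facet (R : realType) (n : nat) (P F : set 'cV[R]_n) : Prop :=
  is_face P F /\ exists d : nat, has_dim P d.+1 /\ has_dim F d.

(* The columns of [H] are the facet normals. *)
Definition polyhedron (R : realType) (n f : nat) (H : 'M[R]_(n, f)) :
  set 'cV[R]_n := [set x | forall i, (H^T *m x) i 0 <= ones R f i 0].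

Definition tight (R : realType) (n f : nat) (P : set 'cV[R]_n)
    (H : 'M[R]_(n, f)) (i : 'I_f) : set 'cV[R]_n :=
  P `&` [set x | dot (col i H) x = 1].

Definition facet_inequalities (R : realType) (n f : nat) (P : set 'cV[R]_n)
    (H : 'M[R]_(n, f)) : Prop :=
  (forall i, is_facet P (tight P H i)) /\
  (forall F, is_facet P F -> exists! i, F = tight P H i).

(* For a linear map given by a matrix [A], the adjoint is [A^T]. *)
Definition nonneg_map (R : realType) (f m : nat) (K : set 'cV[R]_m)
    (A : 'M[R]_(m, f)) : Prop :=
  [set A *m x | x in @orthant R f] `<=` dual_cone K.

(* [f%:R - 1] is subtracted in R; [Num.sqrt] vanishes on negative reals, which
   only matters for [f = 0]. *)
Definition O_in (R : realType) (f : nat) : set 'cV[R]_f :=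
  [set x | Num.sqrt (f%:R - 1) * enorm x <= dot (ones R f) x].

Definition Inn (R : realType) (n f m : nat) (H : 'M[R]_(n, f))
    (K : set 'cV[R]_m) (A : 'M[R]_(m, f)) : set 'cV[R]_n :=
  [set x | exists2 y, K y & O_in (ones R f - H^T *m x - A^T *m y)].

(* Main.v *)
(* Put x = A 1 and let F be the smallest face of C = K^* containing x.  Since
   x is the sum of the A e_i, all of them lie in F, so A^T kills F^perp and
   A^T(K) = A^T(D) with D = K + F^perp, which is closed because C is nice and
   C^* = K.  If y in D and A^T y = 0, then <y, x> = 0, hence y is orthogonal
   to F.  So A^T is injective at 0 on the closed cone D cut by the orthogonal
   complement of F^perp, and by compactness of its unit sphere the image is
   closed.  Finally Inn_P(A) is the preimage of O_in + A^T(K) under an affine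
   map, and a sum of two closed subsets of the nonnegative orthant is closed. *)

Require Import Defs.
From mathcomp Require Import all_boot all_order all_algebra.
From mathcomp Require Import all_classical all_reals all_analysis.
From mathcomp Require Import ring lra.

Set Implicit Arguments.
Unset Strict Implicit.
Unset Printing Implicit Defensive.

Import Order.TTheory GRing.Theory Num.Theory.
Import numFieldNormedType.Exports.

Local Open Scope classical_set_scope.
Local Open Scope ring_scope.

(** * Algebra of the Euclidean inner product *)

Section Dot.
Variables (R : realType) (n : nat).
Implicit Types x y z : 'cV[R]_n.

Lemma dotC x y : dot x y = dot y x.
Proof. by apply: eq_bigr => i _; rewrite mulrC. Qed.

Lemma dotDl x y z : dot (x + y) z = dot x z + dot y z.
Proof. by rewrite -big_split; apply: eq_bigr => i _; rewrite mxE mulrDl. Qed.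

Lemma dotDr x y z : dot z (x + y) = dot z x + dot z y.
Proof. by rewrite !(dotC z) dotDl. Qed.

Lemma dotZl (t : R) x z : dot (t *: x) z = t * dot x z.
Proof. by rewrite mulr_sumr; apply: eq_bigr => i _; rewrite mxE mulrA. Qed.

Lemma dotZr (t : R) x z : dot z (t *: x) = t * dot z x.
Proof. by rewrite !(dotC z) dotZl. Qed.

Lemma dotNl x z : dot (- x) z = - dot x z.
Proof. by rewrite -scaleN1r dotZl mulN1r. Qed.

Lemma dotNr x z : dot z (- x) = - dot z x.
Proof. by rewrite !(dotC z) dotNl. Qed.

Definition dotE := (dotDl, dotDr, dotNl, dotNr, dotZl, dotZr).

Lemma dot0l z : dot 0 z = 0.
Proof. by rewrite -(scale0r 0) dotZl mul0r. Qed.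

Lemma dot_ge0 x : 0 <= dot x x.
Proof. by apply: sumr_ge0 => i _; rewrite -expr2 sqr_ge0. Qed.

Lemma dot_eq0 x : (dot x x == 0) = (x == 0).
Proof.
apply/idP/eqP => [|->]; last by rewrite dot0l.
rewrite psumr_eq0 => [/allP h|i _]; last by rewrite -expr2 sqr_ge0.
apply/colP => i; have := h i (mem_index_enum i).
by rewrite /= mxE -expr2 sqrf_eq0 => /eqP.
Qed.

Lemma sqr_coord_le_dot x i : x i 0 ^+ 2 <= dot x x.
Proof.
rewrite /dot (bigD1 i) //= -expr2 lerDl.
by apply: sumr_ge0 => j _; rewrite -expr2 sqr_ge0.
Qed.

Lemma Cauchy_Schwarz_dot x y : dot x y ^+ 2 <= dot x x * dot y y.
Proof.
have [->|y0] := eqVneq y 0; first by rewrite dotC !dot0l expr0n mulr0.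
have yy : 0 < dot y y by rewrite lt_neqAle eq_sym dot_eq0 y0 dot_ge0.
(* This vector is [dot y y] times the component of [x] orthogonal to [y]; its square norm is
   [dot y y] times the Cauchy-Schwarz gap. *)
have := dot_ge0 (dot y y *: x - dot x y *: y).
rewrite !dotE (dotC y x) => h.
by rewrite -subr_ge0 -(pmulr_rge0 _ yy); lra.
Qed.

End Dot.

Lemma dot_mulmx (R : realType) (m n : nat) (A : 'M[R]_(m, n)) x y :
  dot (A *m x) y = dot x (A^T *m y).
Proof.
rewrite /dot; under eq_bigr => i _ do rewrite mxE mulr_suml.
rewrite exchange_big; apply: eq_bigr => j _; rewrite mxE mulr_sumr.
by apply: eq_bigr => i _; rewrite mxE mulrCA mulrA.
Qed.

(** * Continuity, compact balls and closed images *)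

Section Topology.
Variable R : realType.

Lemma continuous_dot (T : topologicalType) (n : nat) (f g : T -> 'cV[R]_n) :
  continuous f -> continuous g -> continuous (fun t => dot (f t) (g t)).
Proof.
move=> cf cg; apply: continuous_big => [|i _]; first exact: add_continuous.
move=> t; apply: cvgM.
  exact: cvg_comp (cf t) (@coord_continuous _ _ _ i 0 (f t)).
exact: cvg_comp (cg t) (@coord_continuous _ _ _ i 0 (g t)).
Qed.

Lemma continuous_mx (T : topologicalType) (m n : nat) (f : T -> 'M[R]_(m, n)) :
  (forall i j, continuous (fun t => f t i j)) -> continuous f.
Proof.
move=> cf t U [V Vf VU]; apply: (filterS (fun s => VU (f s))) => /=.
by apply: filter_forall => i; apply: filter_forall => j; exact: cf (Vf i j).
Qed.

Lemma continuous_mulmx (m n : nat) (A : 'M[R]_(m, n)) :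
  continuous (fun x : 'cV[R]_n => A *m x).
Proof.
apply: continuous_mx => i j.
rewrite (_ : (fun x => _) = fun x => dot (row i A)^T x).
  by apply: continuous_dot; [exact: cst_continuous|move=> x; exact: cvg_id].
by apply/funext => x; rewrite mxE; apply: eq_bigr => k _; rewrite !mxE ord1.
Qed.

Lemma compact_ball_dot (n : nat) (c : 'cV[R]_n) (M : R) :
  compact [set v | dot (v - c) (v - c) <= M].
Proof.
(* The half-width [M + 1] avoids a square root: if [t ^+ 2 <= M], then [(t - 1) ^+ 2] and
   [(t + 1) ^+ 2] being nonnegative bounds [2 * |t|] by [M + 1]. *)
pose I i := `[c i 0 - (M + 1), c i 0 + (M + 1)]%classic.
have cB := @rV_compact _ n I (fun i => @segment_compact _ _ _).
have cT : continuous (fun v : 'rV[R]_n => v^T : 'cV[R]_n).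
  apply: continuous_mx => i j.
  rewrite (_ : (fun v => _) = fun v : 'rV[R]_n => v j i).
    exact: coord_continuous.
  by apply/funext => x; rewrite mxE.
have cB' : compact
    [set v^T | v in [set v : 'rV[R]_n | forall i, I i (v ord0 i)]].
  by apply: continuous_compact => //; exact: continuous_subspaceT.
apply: subclosed_compact cB' _.
  have cc : continuous (fun v : 'cV[R]_n => v - c).
    move=> v; apply: (@cvgB _ _ _ (nbhs v) _ id (fun=> c)) => //.
    exact: cvg_cst.
  have /continuous_closedP := continuous_dot cc cc.
  by move=> /(_ [set x | x <= M]); apply; exact: closed_le.
move=> v /= vM; exists v^T; last by rewrite trmxK.
move=> i; rewrite /I /= in_itv/= mxE -ler_distl.
have := le_trans (sqr_coord_le_dot (v - c) i) vM; rewrite !mxE.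
move: (v i 0 - c i 0) => t tM; have := sqr_ge0 (t - 1); have := sqr_ge0 (t + 1).
by move=> ? ?; rewrite ler_norml; apply/andP; split; nra.
Qed.

(** Supplies the bounded neighbourhood on which both uses of [closed_image_proper] test
    properness. *)
Lemma nbhs_dot_lt (n : nat) (w : 'cV[R]_n) :
  nbhs w [set v | dot v v < dot w w + 1].
Proof.
have /(_ w) c : continuous (fun v : 'cV[R]_n => dot v v).
  by apply: continuous_dot => v U.
apply: (c [set x | x < dot w w + 1]); apply: open_nbhs_nbhs; split => /=.
  exact: (@open_lt R).
by rewrite ltrDl.
Qed.

(** Near [w] the image of [D] comes from the compact set [D]&[C] alone, whose image is compact,
    hence closed in a Hausdorff space. *)
Lemma closed_image_proper (V W : topologicalType) (g : V -> W) (D : set V) :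
  hausdorff_space W -> continuous g -> closed D ->
  (forall w : W, exists2 U, nbhs w U &
     exists2 C, compact C & D `&` g @^-1` U `<=` C) ->
  closed (g @` D).
Proof.
move=> hW cg cD hD w clw; have [U wU [C cC DUC]] := hD w.
suff [x [Dx _] <-] : (g @` (D `&` C)) w by exists x.
have cDC : compact (D `&` C) by rewrite setIC; exact: compact_closedI.
have : closed (g @` (D `&` C)).
  apply: compact_closed => //; apply: continuous_compact => //.
  exact: continuous_subspaceT.
apply => S wS; have [_ [[x Dx <-] [Sx Ux]]] := clw _ (filterI wS wU).
exists (g x); split => //; exists x => //; split => //; exact: DUC.
Qed.

End Topology.

(** * Projection, biduality and linear images of cones *)

Section ClosedConvexCone.
Variables (R : realType) (n : nat).
Implicit Types (C F : set 'cV[R]_n) (x y : 'cV[R]_n).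

Lemma convex_setP C : (forall t x y, 0 <= t <= 1 -> C x -> C y ->
  C (t *: x + (1 - t) *: y)) -> convex_set C.
Proof.
move=> cC x y t /set_mem Cx /set_mem Cy; apply/mem_set.
by apply: (cC t%:inum) => //; rewrite ge0 le1.
Qed.

Lemma cone_add C x y : closed_convex_cone C -> C x -> C y -> C (x + y).
Proof.
case=> _ sC cC _ Cx Cy.
have h : C (2^-1 *: x + (1 - 2^-1) *: y).
  have h01 : (0 <= 2^-1 :> R) && (2^-1 <= 1 :> R).
    by rewrite invr_ge0 ler0n invf_le1 ?ler1n.
  pose t := Itv01 (proj1 (andP h01)) (proj2 (andP h01)).
  exact: set_mem (cC x y t (mem_set Cx) (mem_set Cy)).
have -> : x + y = 2 *: (2^-1 *: x + (1 - 2^-1) *: y).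
  rewrite scalerDr !scalerA mulrBr mulr1 mulfV ?pnatr_eq0//.
  by rewrite scale1r (_ : 2 - 1 = 1) ?scale1r//; lra.
by apply: sC h; rewrite ler0n.
Qed.

Lemma cone0 C : closed_convex_cone C -> C 0.
Proof. by case=> [[x Cx]] sC _ _; rewrite -(scale0r x); exact: sC. Qed.

Lemma closed_orth_compl F : closed (orth_compl F).
Proof.
rewrite (_ : orth_compl F = \bigcap_(x in F) [set y | dot y x = 0]) //.
apply: closed_bigI => x _.
have : continuous (fun y : 'cV[R]_n => dot y x).
  by apply: continuous_dot; [move=> y U|exact: cst_continuous].
by move=> /continuous_closedP/(_ [set t | t = 0]); apply; exact: closed_eq.
Qed.

Lemma orth_compl_cone F : closed_convex_cone (orth_compl F).
Proof.
split.
- by exists 0 => x _; rewrite dot0l.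
- by move=> t y _ yF x /yF xy; rewrite dotZl xy mulr0.
- apply: convex_setP => t y z _ yF zF x Fx.
  by rewrite !dotE yF // zF // !mulr0 addr0.
- exact: closed_orth_compl.
Qed.

(** Moreau decomposition: [p] is the point of [C] nearest to [y]. Moving from [p] along [c] gives
    the inequality, and shrinking [p] gives the orthogonality. *)
Lemma cone_projection C y : closed_convex_cone C ->
  exists2 p, C p & dot (y - p) p = 0 /\ forall c, C c -> dot (y - p) c <= 0.
Proof.
move=> cC; have [_ sC _ clC] := cC; have C0 := cone0 cC.
pose q p := dot (p - y) (p - y).
have cq : continuous q.
  have cc : continuous (fun v : 'cV[R]_n => v - y).
    move=> v; apply: (@cvgB _ _ _ (nbhs v) _ id (fun=> y)) => //.
    exact: cvg_cst.
  exact: continuous_dot.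
(* Only points at least as close to [y] as [0] compete, which makes the domain compact. *)
have [] := @compact_EVT_min _ R q (C `&` [set p | q p <= q 0]).
- by exists 0; split => //=.
- by rewrite setIC; apply: compact_closedI => //; exact: compact_ball_dot.
- exact: continuous_subspaceT.
move=> p /set_mem [Cp qp0] pmin.
have qmin z : C z -> q p <= q z.
  move=> Cz; have [qz|qz] := leP (q z) (q 0); first by apply: pmin; rewrite inE.
  by rewrite (le_trans qp0) // ltW.
have le0 c : C c -> dot (y - p) c <= 0.
  move=> Cc; rewrite leNgt; apply/negP => pos.
  have cc := dot_ge0 c.
  (* With this step [q] would change by [- t ^+ 2 * (dot c c + 2) < 0]; the [+ 1] keeps the
     denominator positive. *)
  pose t := dot (y - p) c / (dot c c + 1).
  have t0 : 0 < t by rewrite divr_gt0 // ltr_pwDr.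
  have := qmin _ (cone_add cC Cp (sC _ _ (ltW t0) Cc)).
  have -> : q (p + t *: c) = q p - 2 * t * dot (y - p) c + t ^+ 2 * dot c c.
    by rewrite /q !dotE (dotC c p) (dotC c y); ring.
  have -> : dot (y - p) c = t * (dot c c + 1).
    by rewrite divfK // gt_eqF // ltr_pwDr.
  by nra.
exists p => //; split => //; apply/eqP; rewrite eq_le le0 //= leNgt.
apply/negP => neg; have pp := dot_ge0 p.
pose s := dot p p - dot (y - p) p.
have s0 : 0 < s by rewrite /s; lra.
(* Moving from [p] to [(1 - t) p] with this [t] in [0, 1] would decrease [q]. *)
pose t := - dot (y - p) p / s.
have t0 : 0 < t by rewrite divr_gt0 // oppr_gt0.
have t1 : 0 <= 1 - t by rewrite subr_ge0 ler_pdivrMr // mul1r /s; lra.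
have := qmin _ (sC _ _ t1 Cp).
have -> : q ((1 - t) *: p) = q p + 2 * t * dot (y - p) p + t ^+ 2 * dot p p.
  by rewrite /q !dotE (dotC p y); ring.
have : dot (y - p) p = - (t * s) by rewrite divfK ?opprK // gt_eqF.
move: neg pp s0; rewrite /s; move: (dot (y - p) p) (dot p p) => a b.
by move=> a0 b0 ab e; nra.
Qed.

(** If [p] is the projection of [y], then [p - y] lies in the dual cone, so [dot y (y - p) <= 0]; as
    [y - p] is orthogonal to [p], this forces [y = p]. *)
Lemma bipolar C : closed_convex_cone C -> dual_cone (dual_cone C) = C.
Proof.
move=> cC; apply/seteqP; split => [y y2|y Cy c cdual]; last first.
  by rewrite dotC; exact: cdual.
have [p Cp [p0 pC]] := cone_projection y cC.
have : 0 <= dot y (- (y - p)).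
  by apply: y2 => c /pC; rewrite dotNl oppr_ge0.
rewrite dotNr oppr_ge0 dotC => yp.
suff : dot (y - p) (y - p) == 0 by rewrite dot_eq0 subr_eq0 => /eqP ->.
by rewrite eq_le dot_ge0 andbT dotDr dotNr p0 subr0.
Qed.

(** The minimum of [q] on the unit vectors of [D] is positive, and by homogeneity its inverse [M]
    bounds [dot x x] by [M * q x]. So points with bounded image are bounded. *)
Lemma cone_image_closed (m : nat) (B : 'M[R]_(m, n)) (D : set 'cV[R]_n) :
  closed D -> (forall t x, 0 <= t -> D x -> D (t *: x)) ->
  (forall x, D x -> B *m x = 0 -> x = 0) ->
  closed [set B *m x | x in D].
Proof.
move=> clD sD inj.
pose q x := dot (B *m x) (B *m x).
have [M M0 qM] : exists2 M, 0 < M & forall x, D x -> dot x x <= M * q x.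
  pose S := D `&` [set x | dot x x = 1].
  have clS : closed S.
    apply: closedI => //; have : continuous (fun x : 'cV[R]_n => dot x x).
      by apply: continuous_dot => v U.
    by move=> /continuous_closedP/(_ [set t | t = 1]); apply; exact: closed_eq.
  have cS : compact S.
    apply: (subclosed_compact clS (@compact_ball_dot R n 0 1)) => x [_ /= x1].
    by rewrite subr0 x1.
  have normalize x : D x -> x != 0 -> S ((Num.sqrt (dot x x))^-1 *: x).
    move=> Dx x0; split; first by apply: sD; rewrite ?invr_ge0 ?sqrtr_ge0.
    rewrite /= !dotE mulrA -expr2 exprVn sqr_sqrtr ?dot_ge0 //.
    by rewrite mulVf // dot_eq0.
  have [S0|] := pselect (S !=set0); last first.
    move=> S0; exists 1 => // x Dx; have [->|x0] := eqVneq x 0.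
      by rewrite dot0l mul1r dot_ge0.
    by case: S0; exists ((Num.sqrt (dot x x))^-1 *: x); exact: normalize.
  have [|e /set_mem [De e1] emin] := @compact_EVT_min _ R q S S0 cS.
    apply: continuous_subspaceT.
    by apply: continuous_dot; exact: continuous_mulmx.
  have e0 : 0 < q e.
    rewrite lt_neqAle dot_ge0 andbT eq_sym dot_eq0; apply/eqP => /(inj _ De) e0.
    by move: e1; rewrite /= e0 dot0l => /esym/eqP; rewrite oner_eq0.
  exists (q e)^-1; first by rewrite invr_gt0.
  move=> x Dx; have [->|x0] := eqVneq x 0.
    by rewrite dot0l mulr_ge0 ?dot_ge0 // invr_ge0 ltW.
  have /mem_set/emin := normalize _ Dx x0.
  rewrite {2}/q -scalemxAr !dotE mulrA -expr2 exprVn sqr_sqrtr ?dot_ge0 //.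
  rewrite -/(q x) ler_pdivlMl ?(ler_pdivlMl _ _ e0) 1?mulrC //.
  by rewrite lt_neqAle eq_sym dot_eq0 x0 dot_ge0.
apply: closed_image_proper => //.
- exact: continuous_mulmx.
move=> w; exists [set v | dot v v < dot w w + 1]; first exact: nbhs_dot_lt.
exists [set v | dot (v - 0) (v - 0) <= M * (dot w w + 1)].
  exact: compact_ball_dot.
move=> x [Dx /= Bx]; rewrite subr0 (le_trans (qM _ Dx)) //.
by rewrite ler_pM2l // ltW.
Qed.

End ClosedConvexCone.

(** * The face generated by a point *)

Section FaceOfPoint.
Variables (R : realType) (n : nat) (C : set 'cV[R]_n) (x : 'cV[R]_n).
Hypothesis C_cone : closed_convex_cone C.

(** In the order induced by [C], these are the elements of [C] dominated by a nonnegative multiple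
    of [x]. *)
Definition minimal_face : set 'cV[R]_n :=
  [set z | C z /\ exists2 s, 0 <= s & C (s *: x - z)].

Lemma minimal_face_is_face : is_face C minimal_face.
Proof.
have [_ sC _ _] := C_cone; split; first by move=> z [].
- apply: convex_setP => t y z /andP[t0 t1] [Cy [s s0 Cs]] [Cz [r r0 Cr]].
  have t1' : 0 <= 1 - t by rewrite subr_ge0.
  split; first by apply: cone_add => //; exact: sC.
  exists (t * s + (1 - t) * r); first by rewrite addr_ge0 // mulr_ge0.
  have -> : (t * s + (1 - t) * r) *: x - (t *: y + (1 - t) *: z) =
      t *: (s *: x - y) + (1 - t) *: (r *: x - z).
    by rewrite !scalerBr !scalerA scalerDl opprD addrACA.
  by apply: cone_add => //; exact: sC.
suff half y z t : C y -> C z -> 0 < t < 1 ->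
    minimal_face (t *: y + (1 - t) *: z) -> minimal_face y.
  move=> y z t Cy Cz t01 F; split; first exact: half F.
  apply: (half z y (1 - t)) => //; last by rewrite subKr addrC.
  by move: t01 => /andP[t0 t1]; rewrite subr_gt0 t1 /= ltrBlDr ltrDl.
move=> Cy Cz /andP[t0 t1] [_ [s s0 Cs]]; split => //.
(* Adding [(1 - t) *: z] to [s *: x - (t *: y + (1 - t) *: z)] leaves [s *: x - t *: y] in [C]; then
   divide by [t]. *)
exists (t^-1 * s); first by rewrite mulr_ge0 // invr_ge0 ltW.
have Cz' : C ((1 - t) *: z) by apply: sC => //; rewrite subr_ge0 ltW.
have /(sC t^-1) := cone_add C_cone Cs Cz'.
rewrite invr_ge0 (ltW t0) => /(_ isT).
by rewrite opprD addrA subrK scalerBr !scalerA mulVf ?gt_eqF // scale1r.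
Qed.

(* This is how the fact that [x] lies in the relative interior of its minimal
   face is used. *)
Lemma dual_minimal_face_orth y :
  dual_cone minimal_face y -> dot y x = 0 -> orth_compl minimal_face y.
Proof.
move=> dy yx z Fz; apply/eqP; rewrite eq_le dy // andbT.
have [Cz [s s0 Cs]] := Fz.
have : minimal_face (s *: x - z) by split=> //; exists s => //; rewrite subKr.
by move=> /dy; rewrite dotDr dotNr dotZr yx mulr0 sub0r oppr_ge0.
Qed.

End FaceOfPoint.

(** * Sums in the nonnegative orthant and the cone [O_in] *)

Lemma orthant_sum_closed (R : realType) (f : nat) (S T : set 'cV[R]_f) :
  closed S -> closed T -> S `<=` @orthant R f -> T `<=` @orthant R f ->
  closed (minkowski_sum S T).
Proof.
move=> clS clT S0 T0.
have -> : minkowski_sum S T = (fun p => p.1 + p.2) @` (S `*` T).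
  apply/seteqP; split => [_ [x Sx [y Ty <-]]|_ [[x y] [/= Sx Ty] <-]].
    by exists (x, y).
  by exists x => //; exists y.
apply: closed_image_proper.
- exact: (@norm_hausdorff R 'cV[R]_f).
- exact: add_continuous.
- have /continuous_closedP cfst : continuous (@fst 'cV[R]_f 'cV[R]_f).
    by move=> p; exact: cvg_fst.
  have /continuous_closedP csnd : continuous (@snd 'cV[R]_f 'cV[R]_f).
    by move=> p; exact: cvg_snd.
  by apply: closedI; [exact: cfst|exact: csnd].
move=> w; exists [set v | dot v v < dot w w + 1]; first exact: nbhs_dot_lt.
pose B := [set v : 'cV[R]_f | dot (v - 0) (v - 0) <= dot w w + 1].
exists (B `*` B); first by apply: compact_setX; exact: compact_ball_dot.
(* Nonnegative vectors cannot cancel, so a bounded sum has bounded summands. *)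
have orth_le (u v : 'cV[R]_f) : orthant u -> orthant v ->
    dot u u <= dot (u + v) (u + v).
  move=> u0 v0; apply: ler_sum => i _; rewrite mxE.
  by have := u0 i; have := v0 i; nra.
move=> [u v] [[/= Su Tv] /= uv]; rewrite /B /= !subr0.
have [u0 v0] := (S0 _ Su, T0 _ Tv).
split; apply: le_trans (ltW uv); first exact: orth_le.
by rewrite addrC; exact: orth_le.
Qed.

Lemma O_in_closed (R : realType) (f : nat) : closed (@O_in R f).
Proof.
have c1 : continuous (fun x : 'cV[R]_f => dot (ones R f) x).
  by apply: continuous_dot; [exact: cst_continuous|move=> x U].
have c2 : continuous (fun x : 'cV[R]_f => enorm x).
  move=> x.
  apply: (@continuous_comp _ _ _ (fun x => dot x x) Num.sqrt); last first.
    exact: sqrt_continuous.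
  by apply: continuous_dot => y U.
have c3 : continuous (fun x : 'cV[R]_f =>
    dot (ones R f) x - Num.sqrt (f%:R - 1) * enorm x).
  move=> x; apply: (@cvgB _ _ _ (nbhs x) _ (dot (ones R f))
    (fun x => Num.sqrt (f%:R - 1) * enorm x)); first exact: c1.
  apply: (@cvgM _ _ (nbhs x) _ (fun=> _) (@enorm R f)); last exact: c2.
  exact: cvg_cst.
rewrite (_ : @O_in R f = [set x | 0 <=
    dot (ones R f) x - Num.sqrt (f%:R - 1) * enorm x]).
  move/continuous_closedP: c3 => /(_ [set t | 0 <= t]); apply.
  exact: closed_ge.
by apply/seteqP; split => x /=; rewrite subr_ge0.
Qed.

(** If [x i 0 < 0], the vector [e] of ones with entry [i] set to zero has norm [sqrt (f - 1)], yet
    [dot e x] exceeds [dot (ones R f) x], hence also [enorm e * enorm x], against Cauchy-Schwarz. *)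
Lemma O_in_orthant (R : realType) (f : nat) : @O_in R f `<=` @orthant R f.
Proof.
move=> x xO i; rewrite leNgt; apply/negP => xi.
pose e : 'cV[R]_f := \col_j (j != i)%:R.
have ex : dot e x = dot (ones R f) x - x i 0.
  rewrite {2}/dot (bigD1 i) //= mxE mul1r addrC addrK [LHS](bigD1 i) //=.
  rewrite mxE eqxx mul0r add0r; apply: eq_bigr => j ji.
  by rewrite !mxE ji.
have ee : dot e e = f%:R - 1.
  have -> : f%:R = \sum_(j < f) (1 : R) by rewrite sumr_const card_ord.
  rewrite [in RHS](bigD1 i) //= addrC addrK [LHS](bigD1 i) //=.
  rewrite mxE eqxx mul0r add0r; apply: eq_bigr => j ji.
  by rewrite !mxE ji mulr1.
have := Cauchy_Schwarz_dot e x; rewrite ee ex.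
(* The existence of the index [i] excludes [f = 0], so the square root is a genuine one. *)
have f1 : 0 <= f%:R - 1 :> R by rewrite -ee dot_ge0.
have : (Num.sqrt (f%:R - 1) * enorm x) ^+ 2 = (f%:R - 1) * dot x x.
  by rewrite exprMn !sqr_sqrtr ?dot_ge0.
have : 0 <= Num.sqrt (f%:R - 1) * enorm x by rewrite mulr_ge0 ?sqrtr_ge0.
move=> /[swap] <-; move: xO xi; rewrite /O_in /=.
move: (_ * enorm x) (dot (ones R f) x) (x i 0) => a b c ab c0 a0 bca.
have : 0 < (b - c - a) * (b - c + a) by apply: mulr_gt0; lra.
by nra.
Qed.

(** * The image of [K] under the adjoint *)

Section Adjoint.
Variables (R : realType) (f m : nat) (K : set 'cV[R]_m) (A : 'M[R]_(m, f)).
Hypothesis A_nonneg : nonneg_map K A.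

(** Coordinate [i] of [A^T *m y] pairs [y] with [A *m delta_mx i 0], an element of the dual cone. *)
Lemma adjoint_image_orthant : [set A^T *m y | y in K] `<=` @orthant R f.
Proof.
move=> _ [y Ky <-] i; have : dual_cone K (A *m delta_mx i 0).
  apply: A_nonneg; exists (delta_mx i 0) => // j.
  by rewrite mxE; case: (_ && _).
move=> /(_ _ Ky); rewrite dot_mulmx /dot (bigD1 i) //= big1 ?addr0.
  by rewrite mxE !eqxx mul1r.
by move=> j ji; rewrite mxE (negbTE ji) mul0r.
Qed.

Lemma adjoint_image_closed : closed_convex_cone K ->
  nice_cone (dual_cone K) -> closed [set A^T *m y | y in K].
Proof.
move=> K_cone [C_cone niceC]; set C := dual_cone K in C_cone niceC.
have K0 := cone0 K_cone; have [_ sK _ _] := K_cone; have [_ sC _ _] := C_cone.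
have CA v : orthant v -> C (A *m v) by move=> v0; apply: A_nonneg; exists v.
pose x := A *m ones R f.
pose F := minimal_face C x; pose L := orth_compl F.
have L_cone : closed_convex_cone L := orth_compl_cone F.
have [_ sL _ _] := L_cone.
pose D := minkowski_sum K L.
have clD : closed D.
  have := niceC F (minimal_face_is_face x C_cone); by rewrite bipolar.
(* The multiple [s = 1] works because [ones R f - delta_mx i 0] is still in the orthant. *)
have FA i : F (A *m delta_mx i 0).
  split; first by apply: CA => j; rewrite mxE; case: (_ && _).
  exists 1 => //; rewrite scale1r -mulmxBr; apply: CA => j.
  by rewrite !mxE; case: (_ && _); rewrite ?subrr ?subr0.
have AL u : L u -> A^T *m u = 0.
  move=> Lu; apply/colP => i; rewrite [RHS]mxE -(Lu _ (FA i)) dotC dot_mulmx.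
  rewrite /dot (bigD1 i) //= big1 ?addr0.
    by rewrite [delta_mx _ _ _ _]mxE !eqxx mul1r.
  by move=> j ji; rewrite [delta_mx _ _ _ _]mxE (negbTE ji) mul0r.
have DF : D `<=` dual_cone F.
  move=> _ [y Ky [u Lu <-]] z Fz; rewrite dotDl (Lu _ Fz) addr0 dotC.
  by have [Cz _] := Fz; exact: Cz.
(* Removing the lineality space [L] of [D] makes [A^T] injective at [0]. *)
pose D' := D `&` orth_compl L.
have -> : [set A^T *m y | y in K] = [set A^T *m y | y in D'].
  apply/seteqP; split => [_ [y Ky <-]|_ [_ [[y Ky [u Lu <-]] _] <-]]; last first.
    by exists y => //; rewrite mulmxDr (AL u) // addr0.
  (* [L] is a subspace, so the projection inequality applied to [u] and [- u] makes [y - p]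
     orthogonal to [L]. *)
  have [p Lp [_ pL]] := cone_projection y L_cone.
  have NL u : L u -> L (- u) by move=> Lu z Fz; rewrite dotNl Lu // oppr0.
  exists (y - p); last by rewrite mulmxBr (AL p) // subr0.
  split; first by exists y => //; exists (- p) => //; exact: NL.
  move=> u Lu; apply/eqP; rewrite eq_le pL //=.
  by have := pL _ (NL _ Lu); rewrite dotNr oppr_le0.
apply: cone_image_closed.
- by apply: closedI => //; exact: closed_orth_compl.
- move=> t _ t0 [[y Ky [u Lu <-]] uL]; split.
    exists (t *: y); first exact: sK.
    by exists (t *: u); [exact: sL|rewrite scalerDr].
  by move=> z Lz; rewrite dotZl uL // mulr0.
(* From [A^T *m y = 0] follows [dot y x = 0], so [y] lies in [L]; being also orthogonal to [L], it
   is orthogonal to itself. *)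
move=> y [Dy yL] Ay0; apply/eqP; rewrite -dot_eq0; apply/eqP/yL.
apply: dual_minimal_face_orth; first exact: DF.
by rewrite dotC dot_mulmx Ay0 dotC dot0l.
Qed.

End Adjoint.

(** * Closedness of the adjoint image and of the inner approximation *)

Theorem corollary2p15 (R : realType) (n f m : nat) (P : set 'cV[R]_n)
    (H : 'M[R]_(n, f)) (K : set 'cV[R]_m) (A : 'M[R]_(m, f))
    (P_def : P = polyhedron H)
    (P_polytope : is_polytope P)
    (P_fulldim : has_dim P n)
    (P_origin : (interior P) 0)
    (H_facets : facet_inequalities P H)
    (K_cone : closed_convex_cone K)
    (Kdual_nice : nice_cone (dual_cone K))
    (A_nonneg : nonneg_map K A) :
  closed [set A^T *m y | y in K] /\ closed (Inn H K A).
Proof.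
have clAK := adjoint_image_closed A_nonneg K_cone Kdual_nice.
split=> //.
have -> : Inn H K A = (fun x => ones R f - H^T *m x) @^-1`
    minkowski_sum (@O_in R f) [set A^T *m y | y in K].
  apply/seteqP; split => [x [y Ky xy]|x [u Ou [_ [y Ky <-] uy]]].
    exists (ones R f - H^T *m x - A^T *m y) => //.
    by exists (A^T *m y); [exists y|rewrite subrK].
  by exists y => //; rewrite -uy addrK.
have c : continuous (fun x : 'cV[R]_n => ones R f - H^T *m x).
  move=> x; apply: (@cvgB _ _ _ (nbhs x) _ (fun=> ones R f) (mulmx H^T)).
    exact: cvg_cst.
  exact: continuous_mulmx.
move/continuous_closedP: c; apply; apply: orthant_sum_closed => //.
- exact: O_in_closed.
- exact: O_in_orthant.
- exact: adjoint_image_orthant.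
Qed.
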